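(* Let $f\in\mathcal{F}^A_{c_1}(\mathbb{R}^n)$ and $g\in\mathcal{F}_{0}(\mathbb{R}^m)$ with $c_1>0$, and let $(x^k,z^k,\lambda^k)_{k=1}^N$ be generated by ADMM with step length $t>0$ from the starting points $\lambda^0\in\mathbb{R}^r$, $z^0\in\mathbb{R}^m$. If $t\leq c_1$ and $N\geq 4$, then $$\left\|z^N-z^{N-1}\right\|_B\leq \frac{\sqrt{\|\lambda^0-\lambda^\star\|^2+t^2\left\| z^0-z^\star\right\|_B^2}}{(N-1)t}.$$
   Context: Problem: $\min_{(x,z)\in\mathbb{R}^n\times\mathbb{R}^m} f(x)+g(z)$ subject to $Ax+Bz=b$, where $f:\mathbb{R}^n\to\mathbb{R}\cup\{\infty\}$ and $g:\mathbb{R}^m\to\mathbb{R}\cup\{\infty\}$ are closed proper convex functions, $0\neq A\in\mathbb{R}^{r\times n}$, $0\neq B\in\mathbb{R}^{r\times m}$, $b\in\mathbb{R}^r$. The dual objective is $D(\lambda)=\min_{(x,z)} f(x)+g(z)+\langle\lambda,Ax+Bz-b\rangle$ (value $-\infty$ if unbounded below). Standing assumptions: $(x^\star,z^\star)$ is an optimal solution of the problem with corresponding Lagrange multiplier $\lambda^\star$ (a maximizer of $D$); strong duality holds, i.e. $\max_{\lambda} D(\lambda)=\min_{Ax+Bz=b} f(x)+g(z)$; each subproblem of ADMM attains its minimum. ADMM with step length $t>0$ and starting points $\lambda^0,z^0$: for $k=1,\dots,N$, 1. $x^{k}\in\operatorname{argmin}_x f(x)+\langle\lambda^{k-1},Ax\rangle+\tfrac{t}{2}\|Ax+Bz^{k-1}-b\|^2$;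 2. $z^{k}\in\operatorname{argmin}_z g(z)+\langle\lambda^{k-1},Bz\rangle+\tfrac{t}{2}\|Ax^k+Bz-b\|^2$; 3. $\lambda^k=\lambda^{k-1}+t(Ax^k+Bz^k-b)$. Notation: $\|\cdot\|$ is the Euclidean norm; $\|x\|_A=\|Ax\|$ and $\|z\|_B=\|Bz\|$ are seminorms. $\mathcal{F}_0(\mathbb{R}^m)$ is the set of closed proper convex functions on $\mathbb{R}^m$. $\mathcal{F}^A_{c}(\mathbb{R}^n)$ is the set of closed proper functions $f$ on $\mathbb{R}^n$ that are $c$-strongly convex relative to $\|\cdot\|_A$, i.e. $f-\tfrac{c}{2}\|\cdot\|_A^2$ is convex. *)

(* Defs.v *)
From HB Require Import structures.
From mathcomp Require Import all_boot all_order all_algebra.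
From mathcomp Require Import all_classical all_reals all_analysis.

Set Implicit Arguments.
Unset Strict Implicit.
Unset Printing Implicit Defensive.

Import Order.TTheory GRing.Theory Num.Theory.
Import numFieldNormedType.Exports.

Local Open Scope classical_set_scope.
Local Open Scope ring_scope.

Definition dotv (R : realType) (p : nat) (u v : 'cV[R]_p) : R :=
  \sum_(i < p) u i 0 * v i 0.

(* The library norm on matrices is the sup norm, hence this definition. *)
Definition enorm (R : realType) (p : nat) (u : 'cV[R]_p) : R :=
  Num.sqrt (dotv u u).

Definition seminorm_of (R : realType) (r p : nat) (M : 'M[R]_(r, p))
    (u : 'cV[R]_p) : R :=
  enorm (M *m u).

Definition epigraph (R : realType) (p : nat) (h : 'cV[R]_p -> \bar R) :
    set ('cV[R]_p * R) :=
  [set q | (h q.1 <= q.2%:E)%E].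

Definition closed_fun (R : realType) (p : nat) (h : 'cV[R]_p -> \bar R) : Prop :=
  closed (epigraph h).

(* Values in R \cup {+oo}, with nonempty effective domain. *)
Definition proper_fun (R : realType) (p : nat) (h : 'cV[R]_p -> \bar R) : Prop :=
  (forall u, h u != -oo%E) /\ (exists u, h u != +oo%E).

(* Intended for functions that never take the value -oo; 0 * +oo = 0 in \bar R,
   so the endpoints s = 0 and s = 1 are harmless. *)
Definition convex_fun (R : realType) (p : nat) (h : 'cV[R]_p -> \bar R) : Prop :=
  forall (u v : 'cV[R]_p) (s : R), 0 <= s <= 1 ->
    (h (s *: u + (1 - s) *: v)%R <= s%:E * h u + (1 - s)%:E * h v)%E.

Definition F0 (R : realType) (p : nat) (h : 'cV[R]_p -> \bar R) : Prop :=
  [/\ closed_fun h, proper_fun h & convex_fun h].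

Definition Fc (R : realType) (r p : nat) (M : 'M[R]_(r, p)) (c : R)
    (h : 'cV[R]_p -> \bar R) : Prop :=
  [/\ closed_fun h, proper_fun h &
      convex_fun (fun u => h u - (c / 2 * seminorm_of M u ^+ 2)%:E)%E].

Definition is_argmin (R : realType) (T : Type) (h : T -> \bar R) (u : T) : Prop :=
  forall v, (h u <= h v)%E.

Section Problem.
Context (R : realType) (n m r : nat).
Context (f : 'cV[R]_n -> \bar R) (g : 'cV[R]_m -> \bar R).
Context (A : 'M[R]_(r, n)) (B : 'M[R]_(r, m)) (b : 'cV[R]_r).

Definition residual (x : 'cV[R]_n) (z : 'cV[R]_m) : 'cV[R]_r :=
  A *m x + B *m z - b.

Definition feasible : set ('cV[R]_n * 'cV[R]_m) :=
  [set w | A *m w.1 + B *m w.2 = b].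

Definition objective (w : 'cV[R]_n * 'cV[R]_m) : \bar R := (f w.1 + g w.2)%E.

Definition primal_value : \bar R := ereal_inf (objective @` feasible).

Definition optimal_solution (x : 'cV[R]_n) (z : 'cV[R]_m) : Prop :=
  feasible (x, z) /\
  (forall w, feasible w -> (objective (x, z) <= objective w)%E).

Definition lagrangian (w : 'cV[R]_n * 'cV[R]_m) (lam : 'cV[R]_r) : \bar R :=
  (objective w + (dotv lam (residual w.1 w.2))%:E)%E.

Definition dual (lam : 'cV[R]_r) : \bar R :=
  ereal_inf (range (fun w => lagrangian w lam)).

Definition lagrange_multiplier (lam : 'cV[R]_r) : Prop :=
  forall mu, (dual mu <= dual lam)%E.

Definition strong_duality : Prop := ereal_sup (range dual) = primal_value.

Definition x_subproblem (t : R) (lam : 'cV[R]_r) (z : 'cV[R]_m)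
    (x : 'cV[R]_n) : \bar R :=
  (f x + (dotv lam (A *m x) + t / 2 * enorm (residual x z) ^+ 2)%:E)%E.

Definition z_subproblem (t : R) (lam : 'cV[R]_r) (x : 'cV[R]_n)
    (z : 'cV[R]_m) : \bar R :=
  (g z + (dotv lam (B *m z) + t / 2 * enorm (residual x z) ^+ 2)%:E)%E.

(* Only the entries with index at most N are constrained, and x 0 is not. *)
Definition admm (t : R) (N : nat) (lam0 : 'cV[R]_r) (z0 : 'cV[R]_m)
    (x : nat -> 'cV[R]_n) (z : nat -> 'cV[R]_m) (lam : nat -> 'cV[R]_r) : Prop :=
  [/\ lam 0%N = lam0, z 0%N = z0 &
   forall k, (1 <= k <= N)%N ->
     [/\ is_argmin (x_subproblem t (lam k.-1) (z k.-1)) (x k),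
         is_argmin (z_subproblem t (lam k.-1) (x k)) (z k) &
         lam k = lam k.-1 + t *: residual (x k) (z k)]].

End Problem.

(* Main.v *)
(* Subtract the saddle point and rescale by t: write a_k = A (x_k - xstar),
   b_k = B (z_k - zstar), u_k = (lam_k - lamstar) / t, p_k = b_{k-1} - b_k and
   w_k = a_k + b_k = u_k - u_{k-1}.  The two subproblems say that -(u_k + p_k)
   and -u_k are subgradients at a_k and b_k of convex functions F and G, with F
   1-strongly convex because t <= c1, both minimal with value 0 at the origin.
   Put phi_k = - <u_k + p_k, a_k> - F_k and psi_k = - <u_k, b_k> - G_k.  Then
     V_k = |u_k|^2 + |b_k|^2 + 2 (k-1) phi_k + 2 k psi_k + (k^2-1) |w_k|^2
           + (k-1)^2 |p_k|^2 - 2 (k-1) <a_k, w_k> - |a_k|^2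
   satisfies |u_0|^2 + |b_0|^2 >= V_1 + |a_1|^2 >= V_2 >= V_3 >= ... and
   V_N >= (N-1)^2 |p_N|^2, which is the claim. *)
Require Import Defs.
From mathcomp Require Import all_boot all_order all_algebra.
From mathcomp Require Import all_classical all_reals all_analysis.
From mathcomp Require Import ring lra.
Import Order.TTheory GRing.Theory Num.Theory.
Local Open Scope ring_scope.

(** * Energy inequalities for abstract sequences in Euclidean space *)

Section Energy.
Context {R : realType} {r : nat}.
Implicit Types (u v w : 'cV[R]_r).

Lemma dotvC u v : dotv u v = dotv v u.
Proof. by apply: eq_bigr => i _; rewrite mulrC. Qed.

Lemma dotvDl u v w : dotv (u + v) w = dotv u w + dotv v w.
Proof. by rewrite -big_split; apply: eq_bigr => i _; rewrite mxE mulrDl. Qed.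

Lemma dotvZl (k : R) u w : dotv (k *: u) w = k * dotv u w.
Proof. by rewrite mulr_sumr; apply: eq_bigr => i _; rewrite mxE mulrA. Qed.

Lemma dotvNl u w : dotv (- u) w = - dotv u w.
Proof. by rewrite -scaleN1r dotvZl mulN1r. Qed.

Lemma dotvDr u v w : dotv w (u + v) = dotv w u + dotv w v.
Proof. by rewrite dotvC dotvDl !(dotvC w). Qed.

Lemma dotvZr (k : R) u w : dotv w (k *: u) = k * dotv w u.
Proof. by rewrite dotvC dotvZl (dotvC w). Qed.

Lemma dotvNr u w : dotv w (- u) = - dotv w u.
Proof. by rewrite dotvC dotvNl (dotvC w). Qed.

Definition dotvE := (dotvDl, dotvDr, dotvNl, dotvNr, dotvZl, dotvZr).

Lemma dotv_ge0 u : 0 <= dotv u u.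
Proof. by apply: sumr_ge0 => i _; rewrite -expr2 sqr_ge0. Qed.

Lemma enorm_sqr u : enorm u ^+ 2 = dotv u u.
Proof. by rewrite sqr_sqrtr // dotv_ge0. Qed.

(** [b0] stands for the preceding iterate b_{k-1}; [k] is real so that the identities below are
    polynomial in it. *)
Definition lyap (k : R) (b0 u a b : 'cV[R]_r) (F G : R) : R :=
  let p := b0 - b in
  let w := a + b in
  dotv u u + dotv b b
  + 2 * (k - 1) * (- dotv (u + p) a - F) + 2 * k * (- dotv u b - G)
  + (k ^+ 2 - 1) * dotv w w + (k - 1) ^+ 2 * dotv p p
  - 2 * (k - 1) * dotv a w - dotv a a.

(** The two sides differ by a combination of the hypotheses whose weights are nonnegative for k >=
    1. The coefficient 2 k^2 - 3 k - 1 is -2 at k = 1 and positive from k = 2 on, so the first step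
    needs its own argument. *)
Lemma lyap_step (k : R) (b0 u1 a1 b1 u2 a2 b2 : 'cV[R]_r) (F1 G1 F2 G2 : R) :
  1 <= k -> u2 = u1 + a2 + b2 ->
  dotv a2 a2 / 2 <= F2 -> 0 <= G2 ->
  F1 - dotv (u1 + (b0 - b1)) (a2 - a1) + dotv (a2 - a1) (a2 - a1) / 2 <= F2 ->
  F2 - dotv (u2 + (b1 - b2)) (a1 - a2) + dotv (a1 - a2) (a1 - a2) / 2 <= F1 ->
  G1 - dotv u1 (b2 - b1) <= G2 ->
  G2 - dotv u2 (b1 - b2) <= G1 ->
  lyap (k + 1) b1 u2 a2 b2 F2 G2
  + dotv ((k - 1) *: (b0 - b1) - (a2 + k *: (a2 - a1)))
         ((k - 1) *: (b0 - b1) - (a2 + k *: (a2 - a1)))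
  + (2 * k ^+ 2 - 3 * k - 1) * dotv (a2 - a1) (a2 - a1)
  <= lyap k b0 u1 a1 b1 F1 G1.
Proof.
move=> k1 -> I1 I2 A1 A2 B1 B2.
rewrite -subr_ge0.
have k0 : 0 <= k by lra.
set X := (X in 0 <= X).
(* The multipliers solve the dual of the semidefinite performance-estimation
   problem. *)
suff -> : X = 2 * (F2 - dotv a2 a2 / 2) + 2 * G2
  + 2 * (k - 1) * (k + 1) *
    (F2 - (F1 - dotv (u1 + (b0 - b1)) (a2 - a1)
           + dotv (a2 - a1) (a2 - a1) / 2))
  + 2 * k * (k - 1) * (F1 - (F2 - dotv (u1 + a2 + b2 + (b1 - b2)) (a1 - a2)
                       + dotv (a1 - a2) (a1 - a2) / 2))
  + 2 * k * (k + 1) * (G2 - (G1 - dotv u1 (b2 - b1)))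
  + 2 * k ^+ 2 * (G1 - (G2 - dotv (u1 + a2 + b2) (b1 - b2))).
  by rewrite !addr_ge0 ?mulr_ge0 ?subr_ge0 ?exprn_ge0 ?addr_ge0.
rewrite /X /lyap /= !dotvE.
rewrite !(dotvC _ u1) !(dotvC _ a2) (dotvC b1 a1) (dotvC b0 a1) (dotvC b2 a1).
rewrite !(dotvC _ b0) !(dotvC _ b1).
by field.
Qed.

(** At k = 1 the terms carrying k - 1 vanish, and the slack is a weighted sum of the hypotheses plus
    |b0 + a1|^2 + 2 |a1|^2. The |a1|^2 on the left is kept for the passage from V_1 to V_2. *)
Lemma lyap_init (b0 u0 u1 a1 b1 : 'cV[R]_r) (F1 G1 : R) :
  u1 = u0 + a1 + b1 ->
  dotv a1 a1 / 2 <= F1 ->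
  F1 + dotv (u1 + (b0 - b1)) a1 + dotv a1 a1 / 2 <= 0 -> 0 <= G1 ->
  lyap 1 b0 u1 a1 b1 F1 G1 + dotv a1 a1 <= dotv u0 u0 + dotv b0 b0.
Proof.
move=> -> I1 I2 I3; rewrite -subr_ge0; set X := (X in 0 <= X).
suff -> : X = 2 * (F1 - dotv a1 a1 / 2) + 2 * G1 + dotv (b0 + a1) (b0 + a1)
  + 2 * dotv a1 a1
  + 2 * (0 - (F1 + dotv (u0 + a1 + b1 + (b0 - b1)) a1 + dotv a1 a1 / 2)).
  by rewrite !addr_ge0 ?dotv_ge0 // mulr_ge0 ?dotv_ge0 ?subr_ge0.
rewrite /X /lyap /= !dotvE.
rewrite !(dotvC _ u0) !(dotvC _ a1) !(dotvC _ b1).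
by field.
Qed.

(** With w = a + b, the slack is |u|^2 + |a - k w|^2 + (k - 2) |a|^2 plus multiples of the two
    subgradient inequalities tested at the origin. *)
Lemma lyap_ge (k : R) (b0 u a b : 'cV[R]_r) (F G : R) :
  2 <= k ->
  F + dotv (u + (b0 - b)) a + dotv a a / 2 <= 0 -> G + dotv u b <= 0 ->
  (k - 1) ^+ 2 * dotv (b0 - b) (b0 - b) <= lyap k b0 u a b F G.
Proof.
move=> k2 I1 I2; rewrite -subr_ge0; set X := (X in 0 <= X).
suff -> : X = dotv u u + dotv (a - k *: (a + b)) (a - k *: (a + b))
  + (k - 2) * dotv a a + 2 * k * (0 - (G + dotv u b))
  + 2 * (k - 1) * (0 - (F + dotv (u + (b0 - b)) a + dotv a a / 2)).
  have [? ?] : 0 <= k /\ 1 <= k by lra.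
  by rewrite !addr_ge0 ?dotv_ge0 // !mulr_ge0 ?dotv_ge0 ?subr_ge0.
rewrite /X /lyap /= !dotvE.
rewrite !(dotvC _ a) !(dotvC _ b).
by field.
Qed.

Lemma residual_rate (N : nat) (u a b : nat -> 'cV[R]_r) (F G : nat -> R) :
  (2 <= N)%N ->
  (forall k, (1 <= k <= N)%N -> u k = u k.-1 + a k + b k) ->
  (forall i, (1 <= i <= N)%N -> dotv (a i) (a i) / 2 <= F i) ->
  (forall i, (1 <= i <= N)%N ->
     F i + dotv (u i + (b i.-1 - b i)) (a i) + dotv (a i) (a i) / 2 <= 0) ->
  (forall i j, (1 <= i <= N)%N -> (1 <= j <= N)%N ->
     F j - dotv (u j + (b j.-1 - b j)) (a i - a j)
     + dotv (a i - a j) (a i - a j) / 2 <= F i) ->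
  (forall i, (1 <= i <= N)%N -> 0 <= G i) ->
  (forall i, (1 <= i <= N)%N -> G i + dotv (u i) (b i) <= 0) ->
  (forall i j, (1 <= i <= N)%N -> (1 <= j <= N)%N ->
     G j - dotv (u j) (b i - b j) <= G i) ->
  (N%:R - 1) ^+ 2 * dotv (b N.-1 - b N) (b N.-1 - b N)
  <= dotv (u 0%N) (u 0%N) + dotv (b 0%N) (b 0%N).
Proof.
move=> N2 Hu F0 F1 FF G0 G1 GG.
pose V k := lyap k%:R (b k.-1) (u k) (a k) (b k) (F k) (G k).
have step k : (1 <= k)%N -> (k < N)%N ->
    V k.+1 + dotv ((k%:R - 1) *: (b k.-1 - b k) - (a k.+1 + k%:R *: (a k.+1 - a k)))
                  ((k%:R - 1) *: (b k.-1 - b k) - (a k.+1 + k%:R *: (a k.+1 - a k)))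
    + (2 * k%:R ^+ 2 - 3 * k%:R - 1) * dotv (a k.+1 - a k) (a k.+1 - a k) <= V k.
  move=> k1 kN; have k1N : (1 <= k <= N)%N by rewrite k1 ltnW.
  rewrite /V -[k.+1%:R]natr1 /=.
  have kN' : (1 <= k.+1 <= N)%N by [].
  apply: lyap_step; first by rewrite ler1n.
  - exact: Hu kN'.
  - exact: F0 kN'.
  - exact: G0 kN'.
  - exact: FF kN' k1N.
  - exact: FF k1N kN'.
  - exact: GG kN' k1N.
  - exact: GG k1N kN'.
have V1 : V 1%N + dotv (a 1%N) (a 1%N) <= dotv (u 0%N) (u 0%N) + dotv (b 0%N) (b 0%N).
  have h1 : (1 <= 1 <= N)%N by rewrite (ltnW N2).
  by apply: lyap_init; [exact: Hu | exact: F0 | exact: F1 | exact: G0].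
(* At k = 1 the square |2 a_2 - a_1|^2 and the term -2 |a_2 - a_1|^2 add up to 2 |a_2|^2 - |a_1|^2;
   the surplus in [V1] pays for the loss. *)
have V2 : V 2%N <= V 1%N + dotv (a 1%N) (a 1%N).
  have := step 1%N isT N2.
  have := dotv_ge0 (a 2%N).
  rewrite subrr scale0r add0r scale1r !dotvE (dotvC (a 2%N) (a 1%N)).
  by lra.
have Vle k : (2 <= k)%N -> (k <= N)%N -> V k <= V 2%N.
  elim: k => // k IH; rewrite leq_eqVlt => /orP[/eqP <- //|k2 kN].
  apply: le_trans (IH k2 (ltnW kN)).
  apply: le_trans (step k (ltnW k2) kN).
  rewrite -addrA lerDl addr_ge0 ?dotv_ge0 // mulr_ge0 ?dotv_ge0 //.
  have : 2 <= k%:R :> R by rewrite ler_nat.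
  by nra.
apply: (le_trans _ (le_trans (Vle N N2 (leqnn N)) (le_trans V2 V1))).
have NN : (1 <= N <= N)%N by rewrite leqnn (ltnW N2).
by apply: lyap_ge; [rewrite ler_nat | exact: F1 | exact: G1].
Qed.
End Energy.

(** * First-order optimality and duality *)

Lemma ge0_of_small_perturbation (R : realType) (X Y : R) :
  (forall s, 0 < s < 1 -> 0 <= X + s * Y) -> 0 <= X.
Proof.
move=> H; rewrite leNgt; apply/negP => X0.
have Y0 : 0 <= `|Y| by [].
have D0 : 0 < 2 * (`|Y| - X) by lra.
(* For X < 0 this s lies in (0, 1/2] and X + s Y <= X + s (|Y| - X) = X / 2 < 0; subtracting X keeps
   the denominator positive even if Y = 0. *)
have := H (- X / (2 * (`|Y| - X))).
rewrite divr_gt0 ?ltr_pdivrMr //; last by lra.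
rewrite mul1r; have -> : - X < 2 * (`|Y| - X) by lra.
move=> /(_ isT); apply/negP; rewrite -ltNge.
apply: (@le_lt_trans _ _ (X + - X / (2 * (`|Y| - X)) * (`|Y| - X))).
  rewrite lerD2l ler_wpM2l ?divr_ge0 //; [lra | lra |].
  have := ler_norm Y; lra.
have -> : X + - X / (2 * (`|Y| - X)) * (`|Y| - X) = X / 2 by field; lra.
lra.
Qed.

(* First-order optimality without subdifferential calculus: compare u with
   s v + (1 - s) u and let s tend to 0. *)
Lemma argmin_subgradient {R : realType} {r p : nat} {M : 'M[R]_(r, p)} {c t : R}
    {h : 'cV[R]_p -> \bar R} {lam e : 'cV[R]_r} {u v : 'cV[R]_p} :
  (forall w, h w != -oo%E) ->
  convex_fun (fun w => h w - (c / 2 * seminorm_of M w ^+ 2)%:E)%E ->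
  is_argmin (fun w => h w
    + (dotv lam (M *m w) + t / 2 * enorm (M *m w + e) ^+ 2)%:E)%E u ->
  h u \is a fin_num -> h v \is a fin_num ->
  fine (h u) - dotv (lam + t *: (M *m u + e)) (M *m v - M *m u)
  + c / 2 * dotv (M *m v - M *m u) (M *m v - M *m u) <= fine (h v).
Proof.
move=> hN cvx arg hu hv.
(* The second-order term collects c / 2 from the convexity gap s (1 - s) c / 2 and t / 2 from the
   quadratic penalty. *)
rewrite -subr_ge0; apply: (@ge0_of_small_perturbation _ _
  ((c + t) / 2 * dotv (M *m v - M *m u) (M *m v - M *m u))) => s /andP[s0 s1].
have := cvx v u s; rewrite (ltW s0) (ltW s1) => /(_ isT).
have := arg (s *: v + (1 - s) *: u).
have := hN (s *: v + (1 - s) *: u).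
rewrite /seminorm_of !enorm_sqr mulmxDr -!scalemxAr.
move: hu hv; case: (h u) => // hu _; case: (h v) => // hv _.
case: (h _) => [hw _|//|//] /=.
rewrite -!EFinB -!EFinM -!EFinD !lee_fin => H1 H2.
rewrite -(pmulr_rge0 _ s0).
move: H1 H2; rewrite !dotvE.
rewrite !(dotvC (M *m u) (M *m v)) !(dotvC e).
by lra.
Qed.

Lemma argmin_fin_num {R : realType} {p : nat} {h : 'cV[R]_p -> \bar R}
    {q : 'cV[R]_p -> R} {u : 'cV[R]_p} :
  proper_fun h -> is_argmin (fun w => h w + (q w)%:E)%E u -> h u \is a fin_num.
Proof.
move=> [hN [v hv]] /(_ v).
have := hN v; have := hN u; move: hv.
by case: (h v) => // hv _; case: (h u).
Qed.

(** The optimal value is at most the primal value, which strong duality makes the supremum of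
    [dual], attained at [l]; the dual value is an infimum of Lagrangian values. *)
Lemma saddle_point {R : realType} {n m r : nat}
    {f : 'cV[R]_n -> \bar R} {g : 'cV[R]_m -> \bar R}
    {A : 'M[R]_(r, n)} {B : 'M[R]_(r, m)} {b : 'cV[R]_r}
    {xs : 'cV[R]_n} {zs : 'cV[R]_m} {l : 'cV[R]_r} :
  optimal_solution f g A B b xs zs -> lagrange_multiplier f g A B b l ->
  strong_duality f g A B b ->
  forall x z, (f xs + g zs <= f x + g z + (dotv l (residual A B b x z))%:E)%E.
Proof.
move=> [_ opt] mult sd x z.
have primal : (f xs + g zs <= primal_value f g A B b)%E.
  by apply: le_ereal_inf_tmp => _ [w fw <-]; exact: opt.
apply: (le_trans primal); rewrite -sd.
apply: (@le_trans _ _ (dual f g A B b l)).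
  by apply: ge_ereal_sup => _ [mu _ <-]; exact: mult.
by apply: ereal_inf_lbound; exists (x, z).
Qed.

(** Adding the linear term of [l] turns the subgradient -y into l - y = -t xi, and dividing by t
    leaves -xi. *)
Lemma rescaled_subgradient {R : realType} {r : nat} {t q h0 h1 h2 : R}
    {l y xi a1 a2 : 'cV[R]_r} :
  0 < t -> y = l + t *: xi ->
  h1 - dotv y (a2 - a1) + t * q <= h2 ->
  (h1 - h0 + dotv l a1) / t - dotv xi (a2 - a1) + q <= (h2 - h0 + dotv l a2) / t.
Proof.
move=> t0 ->; rewrite !dotvE => H.
rewrite ler_pdivlMr //; set X := h1 - h0 + _.
have -> Y : (X / t - Y + q) * t = X - t * Y + t * q by field; lra.
by rewrite /X; lra.
Qed.

(** * Application to the ADMM iterates *)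

Theorem theorem5 (R : realType) (n m r : nat)
  (f : 'cV[R]_n -> \bar R) (g : 'cV[R]_m -> \bar R)
  (A : 'M[R]_(r, n)) (B : 'M[R]_(r, m)) (b : 'cV[R]_r)
  (c1 t : R) (N : nat)
  (xstar : 'cV[R]_n) (zstar : 'cV[R]_m) (lamstar : 'cV[R]_r)
  (lam0 : 'cV[R]_r) (z0 : 'cV[R]_m)
  (x : nat -> 'cV[R]_n) (z : nat -> 'cV[R]_m) (lam : nat -> 'cV[R]_r) :
  A != 0 -> B != 0 ->
  0 < c1 -> Fc A c1 f -> F0 g ->
  optimal_solution f g A B b xstar zstar ->
  lagrange_multiplier f g A B b lamstar ->
  strong_duality f g A B b ->
  0 < t ->
  admm f g A B b t N lam0 z0 x z lam ->
  t <= c1 -> (4 <= N)%N ->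
  seminorm_of B (z N - z N.-1) <=
    Num.sqrt (enorm (lam0 - lamstar) ^+ 2
              + t ^+ 2 * seminorm_of B (z0 - zstar) ^+ 2)
    / ((N%:R - 1) * t).
Proof.
move=> _ _ _ [_ pf cf] [_ pg cg] opt mult sd t0 [lam00 z00 iter] tc N4.
(* Modulus 0 lets [argmin_subgradient] serve [g] as well. *)
have cg0 : convex_fun (fun w => g w - (0 / 2 * seminorm_of B w ^+ 2)%:E)%E.
  by under eq_fun do rewrite mul0r mul0r sube0.
have feas : A *m xstar + B *m zstar = b := opt.1.
have sad := saddle_point opt mult sd.
(* Test the saddle inequality at a point where both functions are finite. *)
have [fs gs] : f xstar \is a fin_num /\ g zstar \is a fin_num.
  have [[fN [xf fxf]] [gN [zg gzg]]] := (pf, pg).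
  have := sad xf zg.
  move: (fN xf) (gN zg) (fN xstar) (gN zstar) fxf gzg.
  case: (f xf) => // ? _; case: (g zg) => // ? _.
  by case: (f xstar) => // [?|] _; case: (g zstar).
(* Freezing z at [zstar] in the saddle inequality; the zero penalty only gives it the shape of a
   subproblem. *)
have fsarg : is_argmin (fun w => f w
    + (dotv lamstar (A *m w) + 0 / 2 * enorm (A *m w + 0) ^+ 2)%:E)%E xstar.
  move=> w; have := sad w zstar; rewrite /residual -feas.
  move: fs gs; case: (f xstar) => // fx _; case: (g zstar) => // gz _.
  have := pf.1 w; case: (f w) => //= [fw _|_ _]; last by rewrite leey.
  rewrite -!EFinD !lee_fin !dotvE; lra.
have gsarg : is_argmin (fun w => g w
    + (dotv lamstar (B *m w) + 0 / 2 * enorm (B *m w + 0) ^+ 2)%:E)%E zstar.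
  move=> w; have := sad xstar w; rewrite /residual -feas.
  move: fs gs; case: (f xstar) => // fx _; case: (g zstar) => // gz _.
  have := pg.1 w; case: (g w) => //= [gw _|_ _]; last by rewrite leey.
  rewrite -!EFinD !lee_fin !dotvE; lra.
have farg k : (1 <= k <= N)%N -> is_argmin (fun w => f w
    + (dotv (lam k.-1) (A *m w)
       + t / 2 * enorm (A *m w + (B *m z k.-1 - b)) ^+ 2)%:E)%E (x k).
  by move=> /iter[+ _ _] w => /(_ w); rewrite /x_subproblem /residual !addrA.
have garg k : (1 <= k <= N)%N -> is_argmin (fun w => g w
    + (dotv (lam k.-1) (B *m w)
       + t / 2 * enorm (B *m w + (A *m x k - b)) ^+ 2)%:E)%E (z k).
  have E w : residual A B b (x k) w = B *m w + (A *m x k - b).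
    by rewrite /residual (addrC (A *m x k)) addrA.
  by move=> /iter[_ + _] w => /(_ w); rewrite /z_subproblem !E.
have ff k (hk : (1 <= k <= N)%N) := argmin_fin_num pf (farg k hk).
have gf k (hk : (1 <= k <= N)%N) := argmin_fin_num pg (garg k hk).
pose a k := A *m x k - A *m xstar.
pose bz k := B *m z k - B *m zstar.
pose u k := t^-1 *: (lam k - lamstar).
pose F k := (fine (f (x k)) - fine (f xstar) + dotv lamstar (a k)) / t.
pose G k := (fine (g (z k)) - fine (g zstar) + dotv lamstar (bz k)) / t.
have lamE k : (1 <= k <= N)%N -> lam k = lam k.-1 + t *: (a k + bz k).
  move=> /iter[_ _ ->]; congr (_ + _ *: _); rewrite /residual /a /bz -feas.
  by rewrite opprD addrACA.
have key := residual_rate N u a bz F G (ltnW (ltnW N4)).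
have E0 : t ^+ 2 * (dotv (u 0%N) (u 0%N) + dotv (bz 0%N) (bz 0%N))
    = enorm (lam0 - lamstar) ^+ 2 + t ^+ 2 * seminorm_of B (z0 - zstar) ^+ 2.
  rewrite /seminorm_of !enorm_sqr /u /bz lam00 z00 mulmxBr dotvZl dotvZr.
  by field; lra.
(* The x-update sees z^{j-1}, so its multiplier is lam^j + t (b_{j-1} - b_j); the z-update below
   yields lam^j itself. *)
have xiE j : (1 <= j <= N)%N ->
    lam j.-1 + t *: (A *m x j + (B *m z j.-1 - b))
    = lamstar + t *: (u j + (bz j.-1 - bz j)).
  move=> hj; rewrite /u /bz (lamE j hj) /a /bz -feas.
  move: (A *m _) (A *m _) (B *m _) (B *m _) (B *m _) => ? ? ? ? ?.
  by apply/colP => i; rewrite !mxE; field; lra.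
have uE j : (1 <= j <= N)%N ->
    lam j.-1 + t *: (B *m z j + (A *m x j - b)) = lamstar + t *: u j.
  move=> hj; rewrite /u (lamE j hj) /a /bz -feas.
  move: (A *m _) (A *m _) (B *m _) (B *m _) => ? ? ? ?.
  by apply/colP => i; rewrite !mxE; field; lra.
have aB i j : a i - a j = A *m x i - A *m x j by rewrite /a opprB addrA subrK.
have bB i j : bz i - bz j = B *m z i - B *m z j by rewrite /bz opprB addrA subrK.
(* Here t <= c1 enters: after division by t the modulus c1 / t is at least 1. *)
have tc2 (v : 'cV[R]_r) : t * (dotv v v / 2) <= c1 / 2 * dotv v v.
  by have := dotv_ge0 v; nra.
have FF i j : (1 <= i <= N)%N -> (1 <= j <= N)%N ->
     F j - dotv (u j + (bz j.-1 - bz j)) (a i - a j)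
     + dotv (a i - a j) (a i - a j) / 2 <= F i.
  move=> hi hj; apply: (rescaled_subgradient t0 (xiE j hj)); rewrite aB.
  have := argmin_subgradient pf.1 cf (farg j hj) (ff j hj) (ff i hi).
  by apply: le_trans; rewrite lerD2l.
have F0 i : (1 <= i <= N)%N -> dotv (a i) (a i) / 2 <= F i.
  move=> hi; have := argmin_subgradient pf.1 cf fsarg fs (ff i hi).
  rewrite scale0r addr0 -/(a i) => H.
  rewrite /F ler_pdivlMr //; have := tc2 (a i); lra.
have F1 i : (1 <= i <= N)%N ->
    F i + dotv (u i + (bz i.-1 - bz i)) (a i) + dotv (a i) (a i) / 2 <= 0.
  move=> hi; have := argmin_subgradient pf.1 cf (farg i hi) (ff i hi) fs.
  rewrite xiE // -[A *m xstar - _]opprB -/(a i) /F; move: (tc2 (a i)).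
  move: (a i) (u i + (bz i.-1 - bz i)) => v y; rewrite !dotvE opprK => Hv H.
  by rewrite -(pmulr_rle0 _ t0) !mulrDr [t * (_ / t)]mulrC divfK ?gt_eqF //; lra.
have GG i j : (1 <= i <= N)%N -> (1 <= j <= N)%N ->
     G j - dotv (u j) (bz i - bz j) <= G i.
  move=> hi hj; rewrite -[leLHS]addr0.
  apply: (rescaled_subgradient t0 (uE j hj)); rewrite bB mulr0.
  have := argmin_subgradient pg.1 cg0 (garg j hj) (gf j hj) (gf i hi).
  by rewrite !mul0r.
have G0 i : (1 <= i <= N)%N -> 0 <= G i.
  move=> hi; have := argmin_subgradient pg.1 cg0 gsarg gs (gf i hi).
  rewrite scale0r addr0 -/(bz i) => H.
  by rewrite /G divr_ge0 ?(ltW t0) //; lra.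
have G1 i : (1 <= i <= N)%N -> G i + dotv (u i) (bz i) <= 0.
  move=> hi; have := argmin_subgradient pg.1 cg0 (garg i hi) (gf i hi) gs.
  rewrite uE // -[B *m zstar - _]opprB -/(bz i) /G.
  move: (bz i) (u i) => v y; rewrite !dotvE opprK => H.
  by rewrite -(pmulr_rle0 _ t0) !mulrDr [t * (_ / t)]mulrC divfK ?gt_eqF //; lra.
have uS k : (1 <= k <= N)%N -> u k = u k.-1 + a k + bz k.
  move=> hk; rewrite /u (lamE k hk); move: (a k) (bz k) => ? ?.
  by apply/colP => i; rewrite !mxE; field; lra.
have {}key := key uS F0 F1 FF G0 G1 GG.
have N1 : 0 <= N%:R - 1 :> R by rewrite subr_ge0 ler1n (ltn_trans _ N4).
rewrite ler_pdivlMr; last first.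
  by rewrite mulr_gt0 // subr_gt0 ltr1n (ltn_trans _ N4).
(* The left side is nonnegative, so it suffices to compare squares; that is [key] multiplied by
   t^2. *)
rewrite -[leLHS]ger0_norm; last by rewrite !mulr_ge0 ?sqrtr_ge0 ?(ltW t0).
rewrite -sqrtr_sqr ler_wsqrtr // -E0 exprMn /seminorm_of enorm_sqr.
rewrite mulmxBr -bB -opprB dotvNl dotvNr opprK exprMn.
by rewrite mulrA mulrC ler_pM2l ?exprn_gt0 // mulrC.
Qed.
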